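(* Let $1\le c\le n-1$ and $\gamma<0$. For every connected graph $G$ of order $n$ with vertex connectivity $1\le\kappa(G)\le c$, \[{}^0R_{\gamma}(G)\le (n-1)+(n-1)^{\gamma},\] with equality if and only if $G=S_n$.
   Context: ${}^0R_{\gamma}(G)=\sum_{u\in V(G)} d(u)^{\gamma}$. Graphs are finite and simple. $\kappa(G)$ is vertex connectivity. $S_n$ is the star on $n$ vertices. *)

(* Defs.v *)
From HB Require Import structures.
From mathcomp Require Import all_boot all_order all_algebra.
From mathcomp Require Import all_reals.
From mathcomp Require Import exp.

Set Implicit Arguments.
Unset Strict Implicit.
Unset Printing Implicit Defensive.

Import Order.TTheory GRing.Theory Num.Theory.

Record sgraph := SGraph {
  vertex :> finType;
  adj : rel vertex;
  adj_sym : symmetric adj;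
  adj_irr : irreflexive adj }.

Definition degree (G : sgraph) (u : G) : nat := #|[set v | adj u v]|.

Definition adj_in (G : sgraph) (A : {set G}) : rel G :=
  [rel x y | [&& x \in A, y \in A & adj x y]].

(* Any two vertices of the induced subgraph on A are joined by a path inside
   A; vacuous for the empty set. *)
Definition connected_in (G : sgraph) (A : {set G}) : bool :=
  [forall x in A, forall y in A, connect (adj_in A) x y].

Definition connected (G : sgraph) : bool :=
  (0 < #|G|) && connected_in [set: G].

(* Deleting S leaves a disconnected graph or at most one vertex; the second
   clause gives complete graphs K_n the conventional connectivity n - 1. *)
Definition vertex_cut (G : sgraph) (S : {set G}) : bool :=
  (~~ connected_in (~: S)) || (#|~: S| <= 1).

(* The arg min is well defined since [set: G] is a vertex cut. *)
Definition kappa (G : sgraph) : nat :=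
  #|[arg min_(S < [set: G] | vertex_cut S) #|S|]|.

Definition isomorphic (G H : sgraph) : Prop :=
  exists2 f : G -> H, bijective f & forall x y, adj (f x) (f y) = adj x y.

Definition star_adj (n : nat) : rel 'I_n :=
  [rel i j : 'I_n | (i != j) && ((i == 0 :> nat) || (j == 0 :> nat))].

Lemma star_adj_sym n : symmetric (@star_adj n).
Proof. by move=> i j; rewrite /star_adj /= eq_sym orbC. Qed.

Lemma star_adj_irr n : irreflexive (@star_adj n).
Proof. by move=> i; rewrite /star_adj /= eqxx. Qed.

Definition star (n : nat) : sgraph :=
  SGraph (@star_adj_sym n) (@star_adj_irr n).

Local Open Scope ring_scope.

(* Pitfall: powR sends 0 to 0 for a nonzero exponent; this does not matter for
   graphs without isolated vertices. *)
Definition zeroth_randic (R : realType) (gamma : R) (G : sgraph) : R :=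
  \sum_(u : G) (degree u)%:R `^ gamma.

(* Main.v *)
Require Import Defs.
From HB Require Import structures.
From mathcomp Require Import all_boot all_order all_algebra.
From mathcomp Require Import all_reals.
From mathcomp Require Import exp.
From mathcomp Require Import perm zify ring lra.

Set Implicit Arguments.
Unset Strict Implicit.
Unset Printing Implicit Defensive.

Import Order.TTheory GRing.Theory Num.Theory.
Local Open Scope ring_scope.

(** Put [m = n - 1]. For [gamma < 0] the map [x |-> x ^ gamma] is strictly
    convex, so on [[1, m]] it lies below its chord, strictly so inside the
    interval. Summing the chord bound over all degrees gives a decreasing affine
    function of the degree sum, and the degree sum of a connected graph is at
    least [2 m]; this is the inequality. Equality forces every degree to be [1]
    or [m] and the degree sum to be [2 m], hence exactly one vertex is adjacent
    to all the others, which are leaves. *)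

(** * Strict convexity of real powers with a negative exponent *)

Section PowerFunction.
Variable R : realType.
Implicit Types (x y g d m : R).

Lemma ln_lt_subr1 y : 0 < y -> y != 1 -> ln y < y - 1.
Proof.
move=> y0 y1; have : ln y != 0 by rewrite ln_eq0.
by move/expR_gt1Dx; rewrite lnK ?qualifE//=; lra.
Qed.

(** Strict tangent bound at [d]. After division by [d ^ g], with [y = x / d], it follows from
    [ln y < y - 1], reversed by [g < 0], and [1 + t <= expR t] at [t = g * ln y]. *)
Lemma powR_gt_tangent g d x : g < 0 -> 0 < d -> 0 < x -> x != d ->
  d `^ g * (1 + g * (x / d - 1)) < x `^ g.
Proof.
move=> g0 d0 x0 xd; have y0 : 0 < x / d by rewrite divr_gt0.
have y1 : x / d != 1.
  by apply: contra xd => /eqP yE; rewrite -(divfK (lt0r_neq0 d0) x) yE mul1r.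
have -> : x `^ g = d `^ g * (x / d) `^ g.
  by rewrite -powRM ?ltW// mulrC divfK ?gt_eqF.
rewrite ltr_pM2l ?powR_gt0// /powR gt_eqF//.
apply: lt_le_trans (expR_ge1Dx _).
by rewrite ltrD2l ltr_nM2l ?ln_lt_subr1.
Qed.

(** The tangent at [d] is compared with the power at both endpoints [1] and [m]; with weights
    [m - d] and [d - 1] the slope terms cancel. *)
Lemma powR_lt_chord g d m : g < 0 -> 1 < d -> d < m ->
  (m - 1) * d `^ g < (m - d) + (d - 1) * m `^ g.
Proof.
move=> g0 d1 dm; have d0 : 0 < d by lra.
have := @powR_gt_tangent g d 1 g0 d0 ltr01 (ltac:(by rewrite lt_eqF)).
have := @powR_gt_tangent g d m g0 d0 (lt_trans d0 dm) (ltac:(by rewrite gt_eqF)).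
rewrite powR1 -(@ltr_pM2l _ (d - 1)) ?subr_gt0// => Hm.
rewrite -(@ltr_pM2l _ (m - d)) ?subr_gt0// => H1.
have -> : (m - 1) * d `^ g = (m - d) * (d `^ g * (1 + g * (1 / d - 1))) +
    (d - 1) * (d `^ g * (1 + g * (m / d - 1))).
  by field; rewrite gt_eqF.
by rewrite -[m - d in ltRHS]mulr1 ltrD.
Qed.

Lemma powR_lt1 g m : g < 0 -> 1 < m -> m `^ g < 1.
Proof.
move=> g0 m1; rewrite /powR gt_eqF ?(lt_trans ltr01)//.
by rewrite expR_lt1 nmulr_rlt0// ln_gt0.
Qed.

End PowerFunction.

(** * Connectedness and the degree sum *)

Section ConnectedGraph.
Variable G : sgraph.
Implicit Types (u v x y : G) (A : {set G}).

Lemma degree_lt_card u : (degree u < #|G|)%N.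
Proof.
rewrite -cardsT /degree; apply: proper_card; apply/properP; split=> //.
by exists u; rewrite ?inE// adj_irr.
Qed.

(** Without such an edge [A] would be closed under adjacency, so no path could lead from a point of
    [A] to a point outside. *)
Lemma connected_crossing_edge A : connected G -> A != set0 -> A != setT ->
  exists x y, [/\ x \in A, y \notin A & adj x y].
Proof.
move=> /andP[_ /forall_inP conn] /set0Pn[a aA] AT.
have [b bA] : exists b, b \notin A.
  apply/existsP; apply: contraR AT; rewrite negb_exists => /forallP H.
  by apply/eqP/setP => z; rewrite inE; move: (H z); rewrite negbK.
have [/existsP[x /existsP[y /and3P[xA yA xy]]]|none] :=
  boolP [exists x, exists y, [&& x \in A, y \notin A & adj x y]].
  by exists x, y.
have clA : closed (adj_in [set: G]) A.
  have sym : connect_sym (adj_in [set: G]).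
    by apply: sym_connect_sym => x y; rewrite /adj_in /= !in_setT adj_sym.
  apply: (intro_closed sym) => x y; rewrite /adj_in /= !in_setT /= => xy xA.
  apply: contraR none => yA; apply/existsP; exists x; apply/existsP; exists y.
  by rewrite xA yA.
have /forall_inP/(_ b (in_setT b)) := conn a (in_setT a).
by move/(closed_connect clA); rewrite aA (negbTE bA).
Qed.

Lemma degree_gt0 u : connected G -> (1 < #|G|)%N -> (0 < degree u)%N.
Proof.
move=> conn n1.
have [||x [y [/set1P-> _ uy]]] := @connected_crossing_edge [set u] conn.
- by apply/set0Pn; exists u; rewrite inE.
- apply: contraTneq n1 => /(congr1 (fun A : {set G} => #|A|)).
  by rewrite cards1 cardsT => <-.
by rewrite card_gt0; apply/set0Pn; exists y; rewrite inE.
Qed.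

(** Ordered pairs count each edge twice, so on the full vertex set this gives the degree sum. *)
Definition arcs A : {set G * G} :=
  [set p | [&& p.1 \in A, p.2 \in A & adj p.1 p.2]].

Lemma sum_degree_arcs : (\sum_(u : G) degree u = #|arcs setT|)%N.
Proof.
rewrite -sum1_card (eq_bigl (fun p : G * G => true && adj p.1 p.2)); last first.
  by move=> p; rewrite !inE.
rewrite -(pair_big_dep xpredT (fun x y => adj x y) (fun _ _ => 1%N)).
apply: eq_bigr => u _; rewrite /degree -sum1_card.
by apply: eq_bigl => v; rewrite inE.
Qed.

(** Both orientations of the edge [x y] are new, since [y] lies outside [A]. *)
Lemma card_arcsU1 A x y : x \in A -> y \notin A -> adj x y ->
  (#|arcs A| + 2 <= #|arcs (y |: A)|)%N.
Proof.
move=> xA yA xy; have xNy : x != y by apply: contraTneq xA => ->.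
have -> : (#|arcs A| + 2 = #|arcs A :|: [set (x, y); (y, x)]|)%N.
  rewrite cardsU cards2 xpair_eqE (negbTE xNy) /= disjoint_setI0 ?cards0 ?subn0//.
  rewrite disjoint_sym disjoint_subset; apply/subsetP => p /set2P[]->;
  by rewrite !inE (negbTE yA) ?andbF.
apply/subset_leq_card/subsetP => p; rewrite !inE.
case/orP => [/and3P[-> -> ->]|/orP[]/eqP->/=]; rewrite ?orbT// ?eqxx ?xA ?xy ?orbT//.
by rewrite adj_sym xy.
Qed.

Lemma sum_degree_connected : connected G ->
  (2 * (#|G| - 1) <= \sum_(u : G) degree u)%N.
Proof.
move=> conn; have /andP[n0 _] := conn; have [u _] := card_gt0P n0.
(* Instead of a spanning tree, a vertex set is grown from [u]: each crossing edge adds one vertex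
   and at least two arcs. *)
have grow k : (k < #|G|)%N ->
    exists2 A : {set G}, #|A| = k.+1 & (2 * k <= #|arcs A|)%N.
  elim: k => [|k IH] ltk; first by exists [set u]; rewrite ?cards1.
  have [|A cardA arcA] := IH; first lia.
  have [||x [y [xA yA xy]]] := @connected_crossing_edge A conn.
  - by rewrite -card_gt0 cardA.
  - by apply/eqP => /(congr1 (fun A : {set G} => #|A|)); rewrite cardsT; lia.
  exists (y |: A); first by rewrite cardsU1 yA cardA.
  by have := card_arcsU1 xA yA xy; lia.
have [|A cardA arcA] := grow (#|G| - 1)%N; first lia.
rewrite sum_degree_arcs; suff <- : A = setT by [].
by apply/eqP; rewrite eqEcard subsetT cardsT cardA /=; lia.
Qed.

(** * Stars described by their centre, without labelling the vertices *)

Definition star_center u :=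
  forall x y, adj x y = (x != y) && ((x == u) || (y == u)).

Lemma degree_star_center u x : star_center u ->
  degree x = if x == u then (#|G| - 1)%N else 1%N.
Proof.
move=> cu; rewrite /degree; have [->|xu] := eqVneq x u.
  have -> : [set v | adj u v] = [set~ u].
    by apply/setP => v; rewrite !inE cu eqxx andbT eq_sym.
  by rewrite cardsC1; lia.
have -> : [set v | adj x v] = [set u].
  apply/setP => v; rewrite !inE cu (negbTE xu) /=.
  by have [->|] := eqVneq v u; rewrite ?andbF ?xu.
by rewrite cards1.
Qed.

Lemma zeroth_randic_star_center (R : realType) (g : R) u : star_center u ->
  zeroth_randic g G = (#|G|%:R - 1) + (#|G|%:R - 1) `^ g.
Proof.
move=> cu; have n0 : (0 < #|G|)%N by apply/card_gt0P; exists u.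
rewrite /zeroth_randic (bigD1 u)//= (degree_star_center u cu) eqxx natrB//.
rewrite addrC; congr (_ + _).
rewrite (eq_bigr (fun=> 1)) => [|x xu]; last first.
  by rewrite (degree_star_center x cu) (negbTE xu) powR1.
rewrite sumr_const; apply: etrans (natrB R n0); congr (_%:R).
by rewrite subn1 -(cardC1 u); apply: eq_card => x; rewrite !inE.
Qed.

Lemma full_degree_adj u x : degree u = (#|G| - 1)%N -> adj u x = (x != u).
Proof.
move=> du; have : [set v | adj u v] = [set~ u].
  apply/eqP; rewrite eqEcard; apply/andP; split.
    by apply/subsetP => v; rewrite !inE; apply: contraTneq => ->; rewrite adj_irr.
  by rewrite cardsC1 -/(degree u) du; lia.
by move/setP/(_ x); rewrite !inE.
Qed.

(** The vertex [u] uses half of the allowed degree sum, leaving on average one for each other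
    vertex. As each of these is adjacent to [u], it has degree exactly [1]. *)
Lemma star_center_of_degrees u : degree u = (#|G| - 1)%N ->
  (\sum_(x : G) degree x <= 2 * (#|G| - 1))%N -> star_center u.
Proof.
move=> du le_sum.
have ux x : x != u -> adj x u by move=> xu; rewrite adj_sym full_degree_adj.
have ge1 x : x != u -> (1 <= degree x)%N.
  by move=> xu; rewrite card_gt0; apply/set0Pn; exists u; rewrite inE ux.
have d1 x : x != u -> degree x = 1%N.
  move=> xu; apply/eqP; rewrite eqn_leq ge1// andbT.
  move: le_sum; rewrite (bigD1 u)//= du (bigD1 x)//=.
  have : (\sum_(i | (i != u) && (i != x)) 1 <=
          \sum_(i | (i != u) && (i != x)) degree i)%N.
    by apply: leq_sum => i /andP[/ge1].
  have : (#|G| = 2 + \sum_(i : G | (i != u) && (i != x)) 1)%N.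
    by rewrite -sum1_card (bigD1 u)//= (bigD1 x).
  move: (\sum_(i : G | _) 1)%N (\sum_(i : G | _) degree i)%N => a b ->; lia.
move=> x y; have [->|xu] := eqVneq x u.
  by rewrite full_degree_adj// eq_sym andbT.
rewrite /=; have /eqP/cards1P[z xz] := d1 x xu.
have Nx v : adj x v = (v == z) by move/setP/(_ v): xz; rewrite !inE.
have /eqP uz : u == z by rewrite -Nx ux.
by rewrite Nx -uz; have [->|] := eqVneq y u; rewrite ?andbF ?xu.
Qed.

Lemma isomorphic_star_center n : #|G| = n -> (0 < n)%N ->
  isomorphic G (star n) <-> exists u, star_center u.
Proof.
case: n => // n hn _; split=> [[f [f' fK f'K] fadj]|[u cu]].
  exists (f' ord0) => x y; rewrite -fadj /= /star_adj /= (can_eq fK).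
  by congr (_ && (_ || _)); rewrite -(can_eq fK) f'K.
pose r x : 'I_n.+1 := cast_ord hn (enum_rank x).
have rI : injective r by move=> x y /cast_ord_inj/enum_rank_inj.
have fI : injective (fun x => tperm (r u) ord0 (r x)).
  by move=> x y /perm_inj/rI.
(* The transposition corrects the enumeration so that [u] goes to [0], the centre of [star]. *)
exists (fun x => tperm (r u) ord0 (r x) : star n.+1).
  by apply: inj_card_bij => //; rewrite hn card_ord.
move=> x y; rewrite cu /= /star_adj /= (inj_eq fI).
suff E z : (tperm (r u) ord0 (r z) == 0 :> nat) = (z == u) by rewrite !E.
by rewrite -(inj_eq fI) /= tpermL -val_eqE.
Qed.

End ConnectedGraph.

(** * The chord bound summed over the degrees, for order at least three *)

Section ChordBound.
Variables (R : realType) (gamma : R) (G : sgraph).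
Hypotheses (hgamma : gamma < 0) (conn : connected G) (n2 : (2 < #|G|)%N).

Let m : R := #|G|%:R - 1.

(** This is [m - 1] times the chord of the power function over [[1, m]]; the scaling avoids
    division. *)
Let chord (x : R) : R := (m - x) + (x - 1) * m `^ gamma.

Let chord_gap (u : G) : R :=
  chord (degree u)%:R - (m - 1) * (degree u)%:R `^ gamma.

Let m_gt1 : 1 < m.
Proof. by rewrite /m ltrBrDr -(natrD _ 1 1) ltr_nat. Qed.

Let chord_gap_gt0 (u : G) :
  (1 < degree u)%N -> degree u != (#|G| - 1)%N -> 0 < chord_gap u.
Proof.
move=> d1 dm; rewrite /chord_gap subr_gt0 powR_lt_chord//.
  by rewrite ltr1n.
have -> : m = (#|G| - 1)%:R by rewrite natrB//; lia.
by rewrite ltr_nat; have := degree_lt_card u; lia.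
Qed.

Let chord_gap_ge0 (u : G) : 0 <= chord_gap u.
Proof.
have d0 := degree_gt0 u conn (ltnW n2).
have [d1|d1] := eqVneq (degree u) 1%N.
  by rewrite /chord_gap /chord d1 powR1; lra.
have [dm|dm] := eqVneq (degree u) (#|G| - 1)%N.
  by rewrite /chord_gap /chord dm natrB -/m; [lra | lia].
by apply/ltW/chord_gap_gt0 => //; lia.
Qed.

(* The deficit splits into nonnegative parts: the chord gaps and the excess of
   the degree sum over its minimum. *)
Let deficit :
  (m - 1) * (m + m `^ gamma - zeroth_randic gamma G) =
  \sum_(u : G) chord_gap u +
  (1 - m `^ gamma) * ((\sum_(u : G) degree u)%:R - 2 * m).
Proof.
rewrite /chord_gap sumrB -mulr_sumr -/(zeroth_randic gamma G) /chord.
rewrite big_split /= -mulr_suml !sumrB !sumr_const natr_sum cardT -cardE.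
rewrite -(mulr_natr #|G|%:R).
have -> : #|G|%:R = m + 1 by rewrite /m subrK.
by ring.
Qed.

Let slack_ge0 : 0 <= (\sum_(u : G) degree u)%:R - 2 * m.
Proof.
have := sum_degree_connected conn; rewrite -(ler_nat R) natrM natrB -/m; last by lia.
by rewrite subr_ge0.
Qed.

Let gaps_ge0 : 0 <= \sum_(u : G) chord_gap u.
Proof. by apply: sumr_ge0. Qed.

Lemma zeroth_randic_le : zeroth_randic gamma G <= m + m `^ gamma.
Proof.
rewrite -subr_ge0 -(@pmulr_rge0 _ (m - 1)) ?subr_gt0// deficit addr_ge0//.
by rewrite mulr_ge0// subr_ge0 ltW// powR_lt1.
Qed.

Lemma zeroth_randic_eq_star_center :
  zeroth_randic gamma G = m + m `^ gamma -> exists u : G, star_center u.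
Proof.
move=> eq; have M1 : 0 < 1 - m `^ gamma by rewrite subr_gt0 powR_lt1.
have := deficit; rewrite eq subrr mulr0 => /esym/eqP.
(* A zero deficit makes both nonnegative parts vanish: every chord gap, and the excess of the degree
   sum. *)
rewrite paddr_eq0//; last by rewrite mulr_ge0// ltW.
rewrite mulf_eq0 (gt_eqF M1) /= psumr_eq0// => /andP[/allP gap0].
rewrite subr_eq0 => /eqP sum_eq.
have {}sum_eq : (\sum_(u : G) degree u = 2 * (#|G| - 1))%N.
  by apply/eqP; rewrite -(eqr_nat R) sum_eq natrM natrB//; lia.
have d1m (u : G) : degree u != (#|G| - 1)%N -> degree u = 1%N.
  move=> dm; have d0 := degree_gt0 u conn (ltnW n2).
  apply/eqP; rewrite eqn_leq d0 andbT leqNgt; apply/negP => d1.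
  by have := gap0 u (mem_index_enum u); rewrite gt_eqF ?chord_gap_gt0.
have [/existsP[u /eqP du]|] := boolP [exists u : G, degree u == (#|G| - 1)%N].
  by exists u; apply: star_center_of_degrees; rewrite ?sum_eq.
(* If no vertex has full degree, all degrees are [1] and [#|G| = 2 * (#|G| - 1)], which contradicts
   [n2]. *)
rewrite negb_exists => /forallP noc.
move: sum_eq; rewrite (eq_bigr (fun=> 1%N)) => [|u _]; last exact: d1m.
rewrite sum1_card => cardG; have {}cardG : #|G| = (2 * (#|G| - 1))%N := cardG.
by lia.
Qed.

End ChordBound.

(** Order two is treated apart because there [m = 1] and the chord interval collapses to a point. *)
Lemma connected_card2_star_center (G : sgraph) :
  connected G -> #|G| = 2%N -> exists u : G, star_center u.
Proof.
move=> conn n2; have /card_gt0P[u _] : (0 < #|G|)%N by rewrite n2.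
have d1 (x : G) : degree x = 1%N.
  have := degree_lt_card x; have := @degree_gt0 _ x conn; rewrite n2; lia.
exists u; apply: star_center_of_degrees; rewrite ?d1 ?n2//.
by rewrite (eq_bigr (fun=> 1%N)) ?sum1_card ?n2.
Qed.

Theorem theorem3p9 (R : realType) (n c : nat) (gamma : R)
    (hc : (1 <= c <= n - 1)%N) (hgamma : gamma < 0)
    (G : sgraph) (hn : #|G| = n) (hconn : connected G)
    (hkappa : (1 <= kappa G <= c)%N) :
  zeroth_randic gamma G <= (n%:R - 1) + (n%:R - 1) `^ gamma
  /\ (zeroth_randic gamma G = (n%:R - 1) + (n%:R - 1) `^ gamma
      <-> isomorphic G (star n)).
Proof.
have n_gt0 : (0 < n)%N by lia.
rewrite (isomorphic_star_center hn n_gt0).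
(* Since [hc] gives [n >= 2], the first case is [n = 2], where [G] is a star and the bound is
   attained. *)
have [n2|n2] := leqP n 2.
  have [|u cu] := @connected_card2_star_center G hconn; first lia.
  rewrite (zeroth_randic_star_center gamma cu) hn.
  by split=> //; split=> // _; exists u.
have G2 : (2 < #|G|)%N by rewrite hn.
split; first by have := zeroth_randic_le hgamma hconn G2; rewrite hn.
split=> [eq|[u cu]]; last by rewrite (zeroth_randic_star_center gamma cu) hn.
by apply: (zeroth_randic_eq_star_center hgamma hconn G2); rewrite hn.
Qed.
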